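(* Let $r>0$ and let $\{S_n\}$ be a sequence of compact non-empty sets in $\mathbb{R}^d$ satisfying the (outside) $r$-rolling condition. Let $S\subset\mathbb{R}^d$ be a compact non-empty set such that $d_H(S_n,S)\to 0$. Then: (a) $d_H(\partial S_n,\partial S)\to 0$. (b) If $\mathrm{reach}(S_n)\geq r>0$ (for all $n$), then also $d_\nu(S_n,S)\to 0$ for any Borel measure $\nu$ on $\mathbb{R}^d$ which is finite on compact sets and absolutely continuous with respect to the Lebesgue measure $\mu$.
   Context: $\partial A$ denotes the topological boundary of $A\subset\mathbb{R}^d$; $\mathring{B}(x,\rho)$ is the open Euclidean ball with centre $x$ and radius $\rho$. Rolling condition: a set $A\subset\mathbb{R}^d$ fulfills the (outside) $r$-rolling condition if for every $x\in\partial A$ there is a closed ball $B_x$ of radius $r$ such that $x\in B_x$ and $\mathrm{int}(B_x)\cap A=\emptyset$. Reach: let $\mathrm{Unp}(A)$ be the set of points of $\mathbb{R}^d$ having a unique projection (unique nearest point) on $A$. For $x\in A$ let $\mathrm{reach}(A,x)=\sup\{\rho>0:\ \mathring{B}(x,\rho)\subset\mathrm{Unp}(A)\}$, and let $\mathrm{reach}(A)=\inf\{\mathrm{reach}(A,x):\ x\in A\}$. For closed, bounded, non-empty $A,C\subset\mathbb{R}^d$ the Hausdorff distance is $d_H(A,C)=\inf\{\epsilon>0:\ C\subset B(A,\epsilon)\text{ and }A\subset B(C,\epsilon)\}$, where $B(A,\epsilon)=\{x\in\mathbb{R}^d:\ \delta_A(x)\leq\epsilon\}$ and $\delta_A(x)=\inf\{\|x-y\|:\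 y\in A\}$. For Borel sets $A,C$ of finite $\nu$-measure, $d_\nu(A,C)=\nu(A\Delta C)$, where $A\Delta C=(A\setminus C)\cup(C\setminus A)$. *)

(* Defs.v *)
From HB Require Import structures.
From mathcomp Require Import all_boot all_order all_algebra.
From mathcomp Require Import all_classical all_reals all_analysis.
Import Order.TTheory GRing.Theory Num.Theory.
Import numFieldNormedType.Exports.

Set Implicit Arguments.
Unset Strict Implicit.
Unset Printing Implicit Defensive.

Local Open Scope classical_set_scope.
Local Open Scope ring_scope.

(* R^d is 'rV[R]_d. Its library topology is the product topology, i.e. the
   Euclidean one, so compact, closure and interior are the library's. Its library
   norm `|x| is the sup norm: all metric notions below use [enorm] instead. *)

Section euclidean.
Context {R : realType} {d : nat}.
Implicit Types (x y z c : 'rV[R]_d) (A C : set 'rV[R]_d).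

Definition enorm x : R := Num.sqrt (\sum_(i < d) x ord0 i ^+ 2).

Definition open_eball c (rho : R) : set 'rV[R]_d :=
  [set x | enorm (x - c) < rho].

Definition closed_eball c (rho : R) : set 'rV[R]_d :=
  [set x | enorm (x - c) <= rho].

Definition boundary A : set 'rV[R]_d := closure A `\` interior A.

Definition rolling_condition (r : R) A : Prop :=
  forall x, boundary A x ->
    exists c, closed_eball c r x /\ interior (closed_eball c r) `&` A = set0.

Definition is_projection A z p : Prop :=
  A p /\ forall q, A q -> enorm (z - p) <= enorm (z - q).

Definition Unp A : set 'rV[R]_d := [set z | exists! p, is_projection A z p].

(* The maximum with 0 only fixes the supremum of the empty set: a supremum of
   positive radii is taken in [0, +oo]. *)
Definition reach_at A x : \bar R :=
  maxe 0%E (ereal_sup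
    [set rho%:E | rho in [set rho : R | 0 < rho /\ open_eball x rho `<=` Unp A]]).

Definition reach A : \bar R := ereal_inf [set reach_at A x | x in A].

(* Extended-real valued, so that the distance to the empty set is +oo. *)
Definition dist_set A x : \bar R :=
  ereal_inf [set (enorm (x - y))%:E | y in A].

Definition thickening A (eps : R) : set 'rV[R]_d :=
  [set x | (dist_set A x <= eps%:E)%E].

Definition hausdorff_dist A C : \bar R :=
  ereal_inf [set eps%:E | eps in [set eps : R |
    [/\ 0 < eps, C `<=` thickening A eps & A `<=` thickening C eps]]].

End euclidean.

Notation borel_rV R d := (g_sigma_algebraType (@open 'rV[R]_d)).

Section lebesgue.
Context {R : realType} {d : nat}.

Definition box (a b : 'rV[R]_d) : set 'rV[R]_d :=
  [set x | forall i, a ord0 i <= x ord0 i <= b ord0 i].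

(* If b_i < a_i for some i then the box is empty, and this is 0. *)
Definition box_volume (a b : 'rV[R]_d) : R :=
  \prod_(i < d) Num.max 0 (b ord0 i - a ord0 i).

(* Lebesgue outer measure: the infimum of the total volume over all finite or
   countable covers by boxes. Lebesgue measure is its restriction to the measurable
   sets; only its values on Borel sets matter for [`<<]. *)
Definition lebesgue_rV (A : set (borel_rV R d)) : \bar R :=
  ereal_inf [set v : \bar R | exists (D : set nat) (a b : nat -> 'rV[R]_d),
    A `<=` \bigcup_(k in D) box (a k) (b k) /\
    v = \esum_(k in D) (box_volume (a k) (b k))%:E].

End lebesgue.

Definition dist_measure {R : realType} {d : nat}
    (nu : {measure set (borel_rV R d) -> \bar R}) (A C : set 'rV[R]_d) : \bar R :=
  nu (A `+` C).

(* Main.v *)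
Require Import Defs.
From HB Require Import structures.
From mathcomp Require Import all_boot all_order all_algebra.
From mathcomp Require Import all_classical all_reals all_analysis.
From mathcomp Require Import ring lra.
Import Order.TTheory GRing.Theory Num.Theory.
Import numFieldNormedType.Exports.

(** Convergence of the boundaries. A segment with one end inside a set and the
    other outside meets the boundary of the set ([segment_meets_boundary]), so a
    boundary point is found near [x] as soon as a point of the set and a point
    of its complement are found near [x].
    - Next to [x] in the boundary of [S] there are points of [S_ n], because
      [x] is in [S], and a point at positive distance from [S], which [S_ n]
      misses for large [n]. How large depends on [x], and compactness of the
      boundary of [S] makes it uniform ([boundary_limit_eclose]).
    - Next to [x] in the boundary of [S_ n] there are points of [S], because [x]
      is in [S_ n]. Here the rolling condition is essential: the outside ball
      touching [S_ n] at [x] contains smaller balls that touch [S_ n] at [x] too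
      ([rolling_hole]), and the centre of a ball of radius [t] that misses
      [S_ n] cannot lie in [S] once the Hausdorff distance is less than [t]
      ([rolling_boundary_eclose]). A thin hole of [S_ n] that fills up in the
      limit is excluded in this way.

    Convergence in measure. By the same crossing argument the symmetric
    difference of [S_ n] and [S] lies in arbitrarily small neighbourhoods of the
    boundary of [S] ([symdiff_near_boundary]). The measure of these tends to
    the measure of the boundary by continuity from above
    ([small_measure_neighborhood]), so it is enough that the boundary of [S] be
    Lebesgue-null. The outside balls of the sets [S_ n] leave, at every point of
    the boundary of [S] and at every scale [s <= r], a hole of size proportional
    to [s] ([porous_boundary_limit]); that is, the boundary of [S] is porous. A
    porous set is null ([porous_lebesgue_null]): when a cube is cut into [N ^ d]
    equal subcubes with [N] large, one of them misses the set, so repeated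
    subdivision covers the part of the set in the cube with total volume at most
    [(1 - 1 / N ^ d) ^ k] times that of the cube. *)

Set Implicit Arguments.
Unset Strict Implicit.

Local Open Scope classical_set_scope.
Local Open Scope ring_scope.

(** * The Euclidean norm *)

Section EuclideanNorm.
Context {R : realType} {d : nat}.
Implicit Types (x y z c p : 'rV[R]_d) (A C : set 'rV[R]_d).

Let sumsq_ge0 x : 0 <= \sum_(i < d) x ord0 i ^+ 2.
Proof. by apply: sumr_ge0 => i _; exact: sqr_ge0. Qed.

Lemma enorm_ge0 x : 0 <= enorm x.
Proof. exact: sqrtr_ge0. Qed.

Lemma sqr_enorm x : enorm x ^+ 2 = \sum_(i < d) x ord0 i ^+ 2.
Proof. by rewrite /enorm sqr_sqrtr. Qed.

Lemma enorm0 : enorm (0 : 'rV[R]_d) = 0.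
Proof.
rewrite /enorm big1 ?sqrtr0// => i _.
by rewrite mxE expr0n.
Qed.

Lemma enormZ (a : R) x : enorm (a *: x) = `|a| * enorm x.
Proof.
rewrite /enorm -sqrtr_sqr -sqrtrM ?sqr_ge0// mulr_sumr.
by congr Num.sqrt; apply: eq_bigr => i _; rewrite mxE exprMn.
Qed.

Lemma enormN x : enorm (- x) = enorm x.
Proof. by rewrite -scaleN1r enormZ normrN1 mul1r. Qed.

Lemma enormC x y : enorm (x - y) = enorm (y - x).
Proof. by rewrite -enormN opprB. Qed.

Lemma coord_le_enorm x i : `|x ord0 i| <= enorm x.
Proof.
rewrite -sqrtr_sqr ler_sqrt// (bigD1 i)//= lerDl.
by apply: sumr_ge0 => j _; exact: sqr_ge0.
Qed.

Lemma enorm_eq0 x : enorm x = 0 -> x = 0.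
Proof.
move=> x0; apply/rowP => i; rewrite mxE; apply/eqP; rewrite -normr_le0 -x0.
exact: coord_le_enorm.
Qed.

(** Expanding [0 <= sum_i (|y| x_i - |x| y_i)^2] and cancelling [2 |x| |y|]. *)
Lemma enorm_CauchySchwarz x y :
  \sum_(i < d) x ord0 i * y ord0 i <= enorm x * enorm y.
Proof.
have [/enorm_eq0 ->|x0] := eqVneq (enorm x) 0.
  by rewrite enorm0 mul0r big1// => i _; rewrite mxE mul0r.
have [/enorm_eq0 ->|y0] := eqVneq (enorm y) 0.
  by rewrite enorm0 mulr0 big1// => i _; rewrite mxE mulr0.
have xy0 : 0 < enorm x * enorm y.
  by rewrite mulr_gt0// lt_neqAle eq_sym ?x0 ?y0 enorm_ge0.
have : 0 <= \sum_(i < d) (enorm y * x ord0 i - enorm x * y ord0 i) ^+ 2.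
  by apply: sumr_ge0 => i _; exact: sqr_ge0.
have -> : \sum_(i < d) (enorm y * x ord0 i - enorm x * y ord0 i) ^+ 2 =
    enorm y ^+ 2 * enorm x ^+ 2 + enorm x ^+ 2 * enorm y ^+ 2
    - 2 * (enorm x * enorm y) * \sum_(i < d) x ord0 i * y ord0 i.
  transitivity (\sum_(i < d) (enorm y ^+ 2 * x ord0 i ^+ 2
      + enorm x ^+ 2 * y ord0 i ^+ 2
      - 2 * (enorm x * enorm y) * (x ord0 i * y ord0 i))).
    by apply: eq_bigr => i _; ring.
  by rewrite sumrB big_split/= -!mulr_sumr -!sqr_enorm.
move=> h; rewrite -(ler_pM2l xy0); move: h; set s := \sum_(i < d) _.
by move: (enorm x) (enorm y) => a b; nra.
Qed.

Lemma ler_enormD x y : enorm (x + y) <= enorm x + enorm y.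
Proof.
rewrite -(@ler_pXn2r _ 2)// ?nnegrE ?addr_ge0 ?enorm_ge0//.
rewrite sqrrD 2!sqr_enorm (sqr_enorm y).
under eq_bigr do rewrite mxE sqrrD.
rewrite !big_split/= lerD2r lerD2l -mulr2n.
by rewrite ler_pMn2r// enorm_CauchySchwarz.
Qed.

Lemma ler_edistD y x z : enorm (x - z) <= enorm (x - y) + enorm (y - z).
Proof. by rewrite -[x - z](subrKA y) ler_enormD. Qed.

Lemma enorm_le_coord x (e : R) : (forall i, `|x ord0 i| <= e) -> 0 <= e ->
  enorm x <= d%:R * e.
Proof.
move=> xe e0; rewrite -(@ler_pXn2r _ 2)// ?nnegrE ?enorm_ge0 ?mulr_ge0//.
rewrite sqr_enorm (@le_trans _ _ (\sum_(i < d) e ^+ 2))//.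
  apply: ler_sum => i _.
  by rewrite -[leLHS]real_normK ?num_real// ler_pXn2r ?nnegrE.
rewrite sumr_const card_ord exprMn -[leLHS]mulr_natl ler_wpM2r ?sqr_ge0//.
by rewrite -natrX ler_nat; case: (d) => // n; rewrite leq_pmulr.
Qed.

(** Here [`|x|] is the sup norm, from which the topology of ['rV[R]_d] is read
    off; with [norm_le_enorm] this transfers it to the Euclidean norm. *)
Lemma enorm_le_norm x : enorm x <= d%:R * `|x|.
Proof.
apply: enorm_le_coord => // i.
by rewrite [`|x|]mx_normrE (le_trans _ (le_bigmax _ _ (ord0, i))).
Qed.

Lemma norm_le_enorm x : `|x| <= enorm x.
Proof.
rewrite [`|x|]mx_normrE; apply/bigmax_leP; split=> [|[i j] _].
  exact: enorm_ge0.
by rewrite /= (ord1 i) coord_le_enorm.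
Qed.

(** The product topology of ['rV[R]_d] is convertible to that of the sup norm. *)
Let nbhs_norm x A :
  nbhs x A <-> exists2 e : R, 0 < e & forall y, `|x - y| < e -> A y.
Proof. exact: (@nbhs_normP R 'rV[R]_d x A). Qed.

Lemma open_open_eball c (e : R) : open (open_eball c e).
Proof.
suff ball_nbhs x : enorm (x - c) < e -> nbhs x (open_eball c e).
  by rewrite openE => x; exact: ball_nbhs.
move=> xe; apply/nbhs_norm; exists ((e - enorm (x - c)) / d.+1%:R).
  by rewrite divr_gt0// subr_gt0.
move=> y; rewrite ltr_pdivlMr// /open_eball/= => xy.
apply: (le_lt_trans (ler_edistD x _ _)); rewrite -ltrBrDr enormC.
apply: le_lt_trans xy; rewrite (le_trans (enorm_le_norm _))// mulrC.
by rewrite ler_wpM2l// ler_nat.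
Qed.

Lemma nbhs_open_eball x (e : R) : 0 < e -> nbhs x (open_eball x e).
Proof.
move=> e0; apply: open_nbhs_nbhs; split; first exact: open_open_eball.
by rewrite /open_eball/= subrr enorm0.
Qed.

Lemma nbhs_eballP x A :
  nbhs x A <-> exists2 e : R, 0 < e & open_eball x e `<=` A.
Proof.
split=> [/nbhs_norm[e e0 xeA]|[e e0 xeA]].
  exists e => // y; rewrite /open_eball/= => xy; apply: xeA.
  by rewrite (le_lt_trans (norm_le_enorm _))// enormC.
by apply: filterS xeA _; exact: nbhs_open_eball.
Qed.

Lemma bounded_eball A c (M : R) : A `<=` closed_eball c M -> bounded_set A.
Proof.
move=> AM; exists (`|c| + M); split; first exact: num_real.
move=> B cMB x /AM; rewrite /closed_eball/= => xM.
rewrite -(subrK c x) (le_trans (ler_normD _ _))// addrC.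
rewrite (le_trans _ (ltW cMB))// lerD2l.
exact: le_trans (norm_le_enorm _) xM.
Qed.

Lemma compact_sub_eball A : compact A -> exists M : R, A `<=` open_eball 0 M.
Proof.
move=> /compact_bounded[M [_ AM]].
exists (d%:R * (`|M| + 1) + 1) => x Ax; rewrite /open_eball/= subr0.
apply: (le_lt_trans (enorm_le_norm x)).
rewrite ltr_pwDr// ler_wpM2l// AM//.
by rewrite (le_lt_trans (ler_norm _))// ltrDl.
Qed.

End EuclideanNorm.

(** * Hausdorff convergence, crossing the boundary, and rolling balls *)

Lemma cvge0P {R : realType} {T : Type} {F : set_system T} {FF : Filter F}
    (f : T -> \bar R) : (forall t, 0 <= f t)%E ->
  f t @[t --> F] --> 0%E <->
  forall e : R, 0 < e -> \forall t \near F, (f t < e%:E)%E.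
Proof.
move=> f0; split=> [f_cvg e e0|f_lt].
  have : nbhs 0%E [set y : \bar R | (y < e%:E)%E].
    apply: open_nbhs_nbhs; split; first exact: open_ereal_lt_ereal.
    by rewrite /= lte_fin.
  exact: f_cvg.
have f_fin t (e : R) : (f t < e%:E)%E -> f t \is a fin_num.
  by move=> fte; rewrite ge0_fin_numE// (lt_le_trans fte)// leey.
apply/fine_cvgP; split.
  by apply: filterS (f_lt 1 ltr01) => t; exact: f_fin.
apply/cvgrPdist_lt => e e0; apply: filterS (f_lt e e0) => t fte.
rewrite sub0r normrN /= ger0_norm ?fine_ge0//.
by rewrite -lte_fin fineK// (f_fin _ _ fte).
Qed.

Section Hausdorff.
Context {R : realType} {d : nat}.
Implicit Types (x y z c p : 'rV[R]_d) (A C : set 'rV[R]_d).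

(** One side of the Hausdorff comparison; strict inequalities come with
    witnesses, so that it composes without going through infima. *)
Definition eclose (e : R) A C : Prop :=
  forall x, A x -> exists2 y, C y & enorm (x - y) < e.

Lemma hausdorff_dist_ge0 A C : (0 <= hausdorff_dist A C)%E.
Proof.
by apply/ereal_infP => _ [e [e0 _ _] <-]; rewrite lee_fin ltW.
Qed.

Lemma hausdorff_dist_lt A C (e : R) :
  (hausdorff_dist A C < e%:E)%E -> eclose e A C /\ eclose e C A.
Proof.
move=> /ereal_inf_lt[_ [eps [_ CA AC] <-]]; rewrite lte_fin => eps_e.
suff thickeningP B B' : B `<=` thickening B' eps -> eclose e B B'.
  by split; exact: thickeningP.
move=> BB' x /BB'; rewrite /thickening/= => xB'.
have /ereal_inf_lt[_ [y B'y <-]] : (dist_set B' x < e%:E)%E.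
  by rewrite (le_lt_trans xB')// lte_fin.
by rewrite lte_fin => xy; exists y.
Qed.

Lemma hausdorff_dist_le A C (e : R) : 0 < e ->
  eclose e A C -> eclose e C A -> (hausdorff_dist A C <= e%:E)%E.
Proof.
move=> e0 AC CA.
have thickeningS B B' : eclose e B B' -> B `<=` thickening B' e.
  move=> BB' x /BB'[y B'y xy]; rewrite /thickening/=.
  apply: (@le_trans _ _ (enorm (x - y))%:E); last by rewrite lee_fin ltW.
  by apply: ereal_inf_lbound; exists y.
apply: ereal_inf_lbound; exists e => //.
by split => //; exact: thickeningS.
Qed.

Lemma hausdorff_cvg0P (A_ : nat -> set 'rV[R]_d) A :
  hausdorff_dist (A_ n) A @[n --> \oo] --> 0%E <->
  forall e : R, 0 < e ->
    \forall n \near \oo, eclose e (A_ n) A /\ eclose e A (A_ n).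
Proof.
rewrite cvge0P; last by move=> n; exact: hausdorff_dist_ge0.
split=> AA e e0.
  by apply: filterS (AA e e0) => n; exact: hausdorff_dist_lt.
have e20 : 0 < e / 2 by rewrite divr_gt0.
apply: filterS (AA _ e20) => n [AnA AAn].
apply: (@le_lt_trans _ _ (e / 2)%:E); first exact: hausdorff_dist_le.
by rewrite lte_fin ltr_pdivrMr// ltr_pMr// ltr1n.
Qed.

(** A segment is connected, so it cannot leave [A] without meeting the
    boundary; and it stays in every ball that contains its two ends. *)
Lemma segment_meets_boundary A a b : A a -> ~ A b ->
  exists2 z, boundary A z &
    forall p (e : R), enorm (a - p) < e -> enorm (b - p) < e -> enorm (z - p) < e.
Proof.
move=> Aa nAb; pose f (t : R) := a + t *: (b - a).
have cf : continuous f.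
  by move=> t; apply: cvgD; [exact: cvg_cst|apply: cvgZr_tmp; exact: cvg_id].
have [t [t01 ft]] : exists t, `[0, 1]%classic t /\ boundary A (f t).
  apply: contrapT => /forallNP nbd.
  (* Off the boundary, closure and interior agree, so the preimage of [A] is
     both open and closed in the segment. *)
  pose B := `[0%R : R, 1%R]%classic `&` f @^-1` (A°)%classic.
  have BE : B = `[0%R : R, 1%R]%classic.
    apply: segment_connected.
    - exists 0; split; first by rewrite /= in_itv/= lexx ler01.
      have /not_andP[|/not_andP[]] := nbd 0.
      + by rewrite /= in_itv/= lexx ler01.
      + by rewrite /f scale0r addr0 => /(_ (subset_closure Aa)).
      + by move=> /contrapT.
    - exists (f @^-1` (A°)%classic) => //.
      apply: open_comp; first by move=> t _; exact: cf.
      exact: open_interior.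
    - exists (f @^-1` closure A).
        by apply: closed_comp; [move=> t _; exact: cf|exact: closed_closure].
      rewrite /B; apply/seteqP; split=> t [t01 At]; split=> //.
        by apply: subset_closure; exact: interior_subset.
      by have /not_andP[|/not_andP[|/contrapT]] := nbd t.
  have : B 1 by rewrite BE /= in_itv/= lexx ler01.
  move=> [_]; rewrite /= /f scale1r subrKC => /interior_subset.
  exact: nAb.
exists (f t) => // p e ap bp; move: t01; rewrite /= in_itv/= => /andP[t0 t1].
have -> : f t - p = (1 - t) *: (a - p) + t *: (b - p).
  by apply/rowP => i; rewrite !mxE; ring.
apply: (le_lt_trans (ler_enormD _ _)); rewrite !enormZ.
rewrite (ger0_norm t0) ger0_norm ?subr_ge0//.
apply: (@le_lt_trans _ _ (Num.max (enorm (a - p)) (enorm (b - p)))).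
  have : enorm (a - p) <= Num.max (enorm (a - p)) (enorm (b - p)).
    by rewrite le_max lexx.
  have : enorm (b - p) <= Num.max (enorm (a - p)) (enorm (b - p)).
    by rewrite le_max lexx orbT.
  by move: (enorm _) (enorm _) (Num.max _ _) => u v m; nra.
by rewrite gt_max ap.
Qed.

(** Sliding the centre of the ball [B(c, r)] that touches [A] at [x] towards
    [x] leaves smaller balls that still touch [A] at [x] from outside. *)
Lemma rolling_hole (r t : R) A x : rolling_condition r A -> boundary A x ->
  0 < t -> t <= r ->
  exists2 y, enorm (y - x) <= t & A `&` open_eball y t = set0.
Proof.
move=> rA /rA[c [xc cA]] t0 tr; rewrite /closed_eball/= in xc.
have r0 : 0 < r := lt_le_trans t0 tr.
have tr01 : 0 <= t / r <= 1.
  by rewrite divr_ge0 ?(ltW t0) ?(ltW r0)//= ler_pdivrMr// mul1r.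
have [tr0 tr1] := andP tr01.
have trE : t / r * r = t by rewrite divfK// gt_eqF.
exists (x + (t / r) *: (c - x)).
  rewrite addrAC subrr add0r enormZ ger0_norm// enormC.
  by rewrite -[leRHS]trE ler_wpM2l.
apply/seteqP; split=> // z [Az]; rewrite /open_eball/= => zy.
suff : ((closed_eball c r)° `&` A)%classic z by rewrite cA.
split=> //; apply/nbhs_eballP.
suff zc : enorm (z - c) < r.
  exists (r - enorm (z - c)); first by rewrite subr_gt0.
  move=> w; rewrite /open_eball /closed_eball/= ltrBrDr => wz.
  by rewrite ltW// (le_lt_trans (ler_edistD z _ _)).
apply: (le_lt_trans (ler_edistD (x + (t / r) *: (c - x)) _ _)).
have -> : x + (t / r) *: (c - x) - c = (1 - t / r) *: (x - c).
  by apply/rowP => i; rewrite !mxE; ring.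
rewrite enormZ ger0_norm ?subr_ge0//.
have : (1 - t / r) * enorm (x - c) <= (1 - t / r) * r.
  by rewrite ler_wpM2l// subr_ge0.
rewrite [leRHS]mulrBl mul1r trE => xcr.
by rewrite -[ltRHS](subrK t) addrC ler_ltD.
Qed.

End Hausdorff.

(** * Porous sets are Lebesgue-null *)

Section PorousNull.
Context {R : realType} {d : nat}.
Implicit Types (x y z c p a : 'rV[R]_d) (A C K : set 'rV[R]_d).

(** Porosity with constants [q] and [s0] that are the same at all points of
    [K], so that all cubes of side at most [4 * s0] lose the same fraction of
    their volume. *)
Definition porous (q s0 : R) K : Prop :=
  forall x s, K x -> 0 < s -> s <= s0 ->
    exists2 y, enorm (y - x) <= s & K `&` open_eball y (q * s) = set0.

Lemma porousS (q s0 : R) A K : A `<=` K -> porous q s0 K -> porous q s0 A.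
Proof.
move=> AK Kpor x s /AK Kx s_gt0 ss0; have [y yx Ky] := Kpor x s Kx s_gt0 ss0.
by exists y => //; apply: subsetI_eq0 Ky.
Qed.

(** A hole at scale [s * s0 / s1] also serves at the larger scale [s]. This
    allows subdividing at once a single cube that contains [K]. *)
Lemma porous_rescale (q s0 s1 : R) K : 0 < s0 -> s0 <= s1 ->
  porous q s0 K -> porous (q * (s0 / s1)) s1 K.
Proof.
move=> s00 s01 Kpor x s Kx s_gt0 ss1; have s10 := lt_le_trans s00 s01.
have k0 : 0 < s0 / s1 by rewrite divr_gt0.
have [||y yx Ky] := Kpor x (s0 / s1 * s) Kx; first by rewrite mulr_gt0.
  by rewrite -mulrA ger_pMr// mulrC ler_pdivrMr// mul1r.
exists y; last by rewrite -mulrA.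
by rewrite (le_trans yx)// ger_pMl// ler_pdivrMr// mul1r.
Qed.

Definition cube a (l : R) : set 'rV[R]_d := box a (a + const_mx l).

Lemma cubeP a (l : R) x : cube a l x <->
  forall i, a ord0 i <= x ord0 i <= a ord0 i + l.
Proof. by split=> ax i; have := ax i; rewrite !mxE. Qed.

Lemma cube_volume a (l : R) : 0 <= l -> box_volume a (a + const_mx l) = l ^+ d.
Proof.
move=> l0; rewrite /box_volume -[in RHS](card_ord d) -prodr_const.
by apply: eq_bigr => i _; rewrite !mxE addrAC subrr add0r; apply/max_idPr.
Qed.

Lemma cube_diam a (l : R) x y : 0 <= l -> cube a l x -> cube a l y ->
  enorm (x - y) <= d%:R * l.
Proof.
move=> l0 /cubeP ax /cubeP ay; apply: enorm_le_coord => // i.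
have /andP[? ?] := ax i; have /andP[? ?] := ay i.
by rewrite !mxE ler_norml; apply/andP; split; lra.
Qed.

(** The lower corner of the subcube of index [i] when [cube a l] is cut into
    [N ^ d] equal parts. *)
Definition subcorner N a (l : R) (i : {ffun 'I_d -> 'I_N}) : 'rV[R]_d :=
  \row_j (a ord0 j + l / N%:R * (i j)%:R).

Lemma unit_interval_cover N (u : R) : (0 < N)%N -> 0 <= u <= N%:R ->
  exists k : 'I_N, k%:R <= u <= k%:R + 1.
Proof.
case: N => // N _; elim: N => [|N IH] /andP[u0 uN].
  by exists ord0; rewrite u0 add0r.
have [uN'|uN'] := leP u N.+1%:R.
  have [|k ku] := IH; first by rewrite u0.
  by exists (widen_ord (leqnSn _) k).
by exists ord_max; rewrite (ltW uN')/= natr1.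
Qed.

Lemma subcube_cover N a (l : R) x : (0 < N)%N -> 0 < l -> cube a l x ->
  exists i : {ffun 'I_d -> 'I_N}, cube (subcorner a l i) (l / N%:R) x.
Proof.
move=> N0 l0 /cubeP ax; have NR0 : (0 : R) < N%:R by rewrite ltr0n.
have lN0 : 0 < l / N%:R by rewrite divr_gt0.
have /choice[f fP] : forall j : 'I_d, exists k : 'I_N,
    k%:R <= (x ord0 j - a ord0 j) / (l / N%:R) <= k%:R + 1.
  move=> j; apply: unit_interval_cover => //.
  have /andP[xa1 xa2] := ax j.
  rewrite divr_ge0 ?subr_ge0 ?(ltW lN0)//= ler_pdivrMr//.
  by rewrite mulrC divfK ?gt_eqF// lerBlDl.
exists [ffun j => f j]; apply/cubeP => j; rewrite mxE ffunE.
have := fP j; rewrite ler_pdivlMr// ler_pdivrMr//.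
by move: (l / N%:R) => h; lra.
Qed.

(** If the subcube at the centre of a cube meets [K], the hole that [K] leaves
    next to a common point contains a whole subcube when [N] is large. *)
Lemma porous_free_subcube (q s0 : R) K N a (l : R) :
  porous q s0 K -> 4 <= N%:R :> R -> 4 * d%:R < q * N%:R ->
  0 < l -> l <= 4 * s0 ->
  exists i : {ffun 'I_d -> 'I_N},
    K `&` cube (subcorner a l i) (l / N%:R) = set0.
Proof.
move=> Kpor N4 Nq l0 ls0.
have NR0 : (0 : R) < N%:R by lra.
have N0 : (0 < N)%N by rewrite -(ltr0n R).
have lN4 : l / N%:R <= l / 4.
  by rewrite ler_wpM2l ?(ltW l0)// lef_pV2// posrE.
pose c := a + const_mx (l / 2).
have [|i0 ci0] := @subcube_cover N a l c N0 l0.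
  by apply/cubeP => j; rewrite /c !mxE; lra.
have [?|/set0P[x [Kx xi0]]] :=
    eqVneq (K `&` cube (subcorner a l i0) (l / N%:R)) set0.
  by exists i0.
(* In each coordinate [x] is within [l / N <= l / 4] of the centre, so a hole at
   scale [l / 4] has its centre in the cube; its radius [q * l / 4] exceeds the
   diameter of the subcubes, which is at most [d * l / N]. *)
have [||y yx Ky] := Kpor x (l / 4) Kx; [lra|lra|].
have [|i yi] := @subcube_cover N a l y N0 l0.
  apply/cubeP => j.
  have /cubeP/(_ j) := ci0; have /cubeP/(_ j) := xi0; rewrite /c !mxE.
  have := le_trans (coord_le_enorm (y - x) j) yx; rewrite !mxE ler_norml.
  by move: (l / N%:R) lN4 => h; move: (h * _) => u; lra.
exists i; apply/seteqP; split=> // z [Kz zi].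
suff : (K `&` open_eball y (q * (l / 4))) z by rewrite Ky.
split=> //; rewrite /open_eball/=.
apply: (le_lt_trans (cube_diam _ zi yi)); first by rewrite divr_ge0// ltW.
rewrite !mulrA ltr_pdivrMr// mulrAC ltr_pdivlMr//.
by rewrite mulrAC [ltRHS]mulrAC ltr_pM2r// mulrC.
Qed.

(** Every subdivision loses one subcube out of [N ^ d] and hence the fixed
    fraction [1 / N ^ d] of the volume. *)
Lemma porous_cube_cover (q s0 : R) K N :
  porous q s0 K -> 4 <= N%:R :> R -> 4 * d%:R < q * N%:R ->
  forall k a (l : R), 0 < l -> l <= 4 * s0 ->
  exists s : seq ('rV[R]_d * 'rV[R]_d),
    (forall x, K x -> cube a l x -> exists2 p, p \in s & box p.1 p.2 x) /\
    \sum_(p <- s) box_volume p.1 p.2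
      <= l ^+ d * (1 - (N%:R ^+ d)^-1) ^+ k.
Proof.
move=> Kpor N4 Nq; have NR0 : (0 : R) < N%:R by lra.
have N0 : (0 < N)%N by rewrite -(ltr0n R).
have Nd0 : N%:R ^+ d != 0 :> R by rewrite expf_neq0// gt_eqF.
elim=> [|k IH] a l l0 ls0.
  exists [:: (a, a + const_mx l)]; split.
    by move=> x _ ax; exists (a, a + const_mx l) => //; rewrite mem_head.
  by rewrite big_seq1 expr0 mulr1 /= cube_volume// ltW.
have [i0 Ki0] := porous_free_subcube a Kpor N4 Nq l0 ls0.
have lN0 : 0 < l / N%:R by rewrite divr_gt0.
have lNl : l / N%:R <= l.
  by rewrite ler_pdivrMr// ler_pMr//; lra.
have /choice[f fP] := fun i : {ffun 'I_d -> 'I_N} =>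
  IH (subcorner a l i) (l / N%:R) lN0 (le_trans lNl ls0).
exists (flatten [seq f i | i <- enum (predC1 i0)]); split.
  move=> x Kx ax; have [i ix] := subcube_cover N0 l0 ax.
  have [p pf px] := (fP i).1 x Kx ix.
  exists p => //; apply/flattenP; exists (f i) => //; apply/map_f.
  rewrite mem_enum inE; apply/eqP => ii0.
  suff : (K `&` cube (subcorner a l i0) (l / N%:R)) x by rewrite Ki0.
  by rewrite -ii0.
rewrite big_flatten/= big_map big_enum/=.
apply: (@le_trans _ _ (\sum_(i in predC1 i0)
    (l / N%:R) ^+ d * (1 - (N%:R ^+ d)^-1) ^+ k)).
  by apply: ler_sum => i _; exact: (fP i).2.
rewrite sumr_const cardC1 card_ffun !card_ord -[leLHS]mulr_natr.
rewrite -subn1 natrB ?expn_gt0 ?N0// natrX exprS expr_div_n.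
rewrite le_eqVlt; apply/orP; left; apply/eqP; field.
exact: Nd0.
Qed.

Lemma lebesgue_rV_eq0 A :
  (forall e : R, 0 < e -> exists s : seq ('rV[R]_d * 'rV[R]_d),
    (forall x, A x -> exists2 p, p \in s & box p.1 p.2 x) /\
    \sum_(p <- s) box_volume p.1 p.2 <= e) ->
  lebesgue_rV A = 0%E.
Proof.
have vol_ge0 (a b : 'rV[R]_d) : 0 <= box_volume a b.
  by apply: prodr_ge0 => i _; rewrite le_max lexx.
move=> Acov; apply/eqP; rewrite eq_le; apply/andP; split; last first.
  apply/ereal_infP => _ [D [a [b [_ ->]]]].
  by apply: esum_ge0 => k _; rewrite lee_fin.
apply/lee_addgt0Pr => e /Acov[s [As se]]; rewrite add0e.
pose a k := (nth (0, 0) s k).1; pose b k := (nth (0, 0) s k).2.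
apply: (@le_trans _ _ (\sum_(p <- s) box_volume p.1 p.2)%:E); last first.
  by rewrite lee_fin.
apply: ereal_inf_lbound; exists `I_(size s), a, b; split.
  move=> x /As[p ps px]; exists (index p s); first by rewrite /= index_mem.
  by rewrite /a /b nth_index.
rewrite esum_fset//; last by move=> k _; rewrite lee_fin.
by rewrite -fsbig_ord/= sumEFin (big_nth (0, 0)) big_mkord.
Qed.

Theorem porous_lebesgue_null (q s0 : R) K : 0 < q -> 0 < s0 ->
  compact K -> porous q s0 K -> forall A, A `<=` K -> lebesgue_rV A = 0%E.
Proof.
move=> q0 s00 /compact_sub_eball[M KM] Kpor A AK.
apply: lebesgue_rV_eq0 => e e0.
(* The cube of side [L] around the origin contains [K], and [s0 <= L]. *)
pose L := 2 * (`|M| + s0).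
have L0 : 0 < L by rewrite mulr_gt0// ltr_wpDl.
have s0L : s0 <= L by rewrite /L; have := normr_ge0 M; lra.
have {}Kpor := porousS AK (porous_rescale s00 s0L Kpor).
set q' := q * (s0 / L) in Kpor.
have q'0 : 0 < q' by rewrite mulr_gt0// divr_gt0.
pose N := (4 + Num.bound (4 * d%:R / q'))%N.
have N4 : 4 <= N%:R :> R by rewrite ler_nat leq_addr.
have Nq : 4 * d%:R < q' * N%:R.
  rewrite [ltRHS]mulrC -ltr_pdivrMr//.
  apply: (lt_le_trans (archi_boundP _)).
    by rewrite divr_ge0 ?(ltW q'0)// mulr_ge0.
  by rewrite ler_nat leq_addl.
set th : R := 1 - (N%:R ^+ d)^-1.
have th01 : 0 <= th < 1.
  have Nd : 1 <= N%:R ^+ d :> R by rewrite exprn_ege1//; lra.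
  have Nd0 : 0 < N%:R ^+ d :> R by lra.
  by rewrite subr_ge0 invf_le1// Nd/= ltrBlDr ltrDl invr_gt0.
have [k kP] : exists k, L ^+ d * th ^+ k <= e.
  have : L ^+ d * th ^+ k @[k --> \oo] --> L ^+ d * 0.
    apply: cvgM; first exact: cvg_cst.
    by apply: cvg_expr; rewrite ger0_norm; case/andP: th01.
  rewrite mulr0 => /cvgrPdist_le/(_ e e0)/filter_ex[k].
  by rewrite sub0r normrN => /(le_trans (ler_norm _)); exists k.
have [|s [sP se]] := porous_cube_cover Kpor N4 Nq k (const_mx (- (L / 2))) L0.
  by lra.
exists s; split; last exact: le_trans se kP.
move=> x Ax; apply: sP => //; apply/cubeP => i; rewrite mxE.
have := KM _ (AK _ Ax); rewrite /open_eball/= subr0.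
have := ler_norm M; have := coord_le_enorm x i; rewrite ler_norml /L.
by lra.
Qed.

End PorousNull.

(** * Convergence of the boundaries *)

Section BoundaryConvergence.
Context {R : realType} {d : nat}.
Implicit Types (x y z c p : 'rV[R]_d) (A C K : set 'rV[R]_d).

Lemma compact_rV_closed A : compact A -> closed A.
Proof. by move=> cA; apply: compact_closed => //; exact: norm_hausdorff. Qed.

Lemma closed_boundary A : closed (boundary A).
Proof.
apply: closedI; first exact: closed_closure.
by apply: open_closedC; exact: open_interior.
Qed.

Lemma boundary_sub A : closed A -> boundary A `<=` A.
Proof. by move=> /closure_id cA x [+ _]; rewrite -cA. Qed.

Lemma compact_boundary A : compact A -> compact (boundary A).
Proof.
move=> cA; apply: (subclosed_compact _ cA); first exact: closed_boundary.
by apply: boundary_sub; exact: compact_rV_closed.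
Qed.

(** The hole of radius [t] that the rolling ball leaves next to a boundary point
    of [A] is too large for its centre to lie in [C]. *)
Lemma rolling_boundary_eclose (r e t : R) A C :
  closed A -> rolling_condition r A -> 0 < t -> t < e -> t <= r ->
  eclose t A C -> eclose t C A -> eclose e (boundary A) (boundary C).
Proof.
move=> clA rA t0 te tr AC CA x bx.
have [a Ca xa] := AC _ (boundary_sub clA bx).
have [y yx hole] := rolling_hole rA bx t0 tr.
have nCy : ~ C y.
  move=> /CA[y' Ay' yy'].
  suff : (A `&` open_eball y t) y' by rewrite hole.
  by split=> //; rewrite /open_eball/= enormC.
have [z bz /(_ x e) zx] := segment_meets_boundary Ca nCy.
exists z => //; rewrite enormC; apply: zx; last exact: le_lt_trans yx te.
by rewrite enormC (lt_trans xa).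
Qed.

(** Near a boundary point of [C] there is a point at positive distance from [C],
    which the sets [A_ n] eventually miss, while they have points near every
    point of [C]. Compactness makes this uniform over the boundary. *)
Lemma boundary_limit_eclose (A_ : nat -> set 'rV[R]_d) C : compact C ->
  (forall e : R, 0 < e ->
    \forall n \near \oo, eclose e (A_ n) C /\ eclose e C (A_ n)) ->
  forall e : R, 0 < e ->
    \forall n \near \oo, eclose e (boundary C) (boundary (A_ n)).
Proof.
move=> cC AC e e0; have clC := compact_rV_closed cC.
have /compact_near_coveringP/(_ _ \oo
  (fun n x => exists2 z, boundary (A_ n) z & enorm (x - z) < e)) :=
  compact_boundary cC.
apply=> x bx; have e20 : 0 < e / 2 by rewrite divr_gt0.
have [b nCb bx2] : exists2 b, ~ C b & enorm (b - x) < e / 2.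
  apply: contrapT => /forall2NP nC; case: bx => _; apply.
  apply/nbhs_eballP; exists (e / 2) => // b xb.
  by apply: contrapT => nCb; case: (nC b).
have /nbhs_eballP[h h0 bh] : nbhs b (~` C).
  by apply: open_nbhs_nbhs; split=> //; exact: closed_openC.
have Cx := boundary_sub clC bx.
exists (open_eball x (e / 2),
        [set n | eclose h (A_ n) C /\ eclose (e / 2) C (A_ n)]).
  split=> /=; first exact: nbhs_open_eball.
  by apply: filterS2 (AC _ h0) (AC _ e20) => n [? _] [_ ?].
move=> [y n] [/=]; rewrite /open_eball/= => yx [AnC CAn].
have [a Aa xa] := CAn _ Cx.
have nAb : ~ A_ n b.
  by move=> /AnC[w Cw bw]; apply: (bh w) Cw; rewrite /open_eball/= enormC.
have eE : e = e / 2 + e / 2 by lra.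
have [z bz /(_ y e) zy] := segment_meets_boundary Aa nAb.
exists z => //; rewrite enormC; apply: zy.
  apply: le_lt_trans (ler_edistD x _ _) _.
  by rewrite [ltRHS]eE ltrD// enormC.
apply: le_lt_trans (ler_edistD x _ _) _.
by rewrite [ltRHS]eE ltrD// enormC.
Qed.

Theorem boundary_hausdorff_cvg (r : R) (A_ : nat -> set 'rV[R]_d) C : 0 < r ->
  (forall n, closed (A_ n)) -> (forall n, rolling_condition r (A_ n)) ->
  compact C ->
  hausdorff_dist (A_ n) C @[n --> \oo] --> 0%E ->
  hausdorff_dist (boundary (A_ n)) (boundary C) @[n --> \oo] --> 0%E.
Proof.
move=> r0 clA rA cC /hausdorff_cvg0P AC; apply/hausdorff_cvg0P => e e0.
pose t := Num.min (e / 2) r.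
have t0 : 0 < t by rewrite lt_min r0 divr_gt0.
have te : t < e by rewrite gt_min ltr_pdivrMr// ltr_pMr// ltr1n.
have tr : t <= r by rewrite ge_min lexx orbT.
apply: filterS2 (AC _ t0) (boundary_limit_eclose cC AC e0) => n [AnC CAn] bCA.
by split=> //; exact: (rolling_boundary_eclose (clA n) (rA n) t0 te tr).
Qed.

(** A point of only one of the sets is close to a point of the other one, and
    the segment between the two meets the boundary of the set that misses
    [x]; if this is [A], one more step leads to the boundary of [C]. *)
Lemma symdiff_near_boundary (e : R) A C : 0 < e ->
  eclose e A C -> eclose e C A -> eclose e (boundary A) (boundary C) ->
  eclose (e + e) (A `+` C) (boundary C).
Proof.
move=> e0 AC CA bAC x [[Ax nCx]|[Cx nAx]].
  have [y Cy xy] := AC _ Ax.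
  have [z bz /(_ x e) zx] := segment_meets_boundary Cy nCx.
  exists z => //; rewrite enormC (lt_trans (zx _ _)) ?ltrDl//.
    by rewrite enormC.
  by rewrite subrr enorm0.
have [y Ay xy] := CA _ Cx.
have [z bz /(_ x e) zx] := segment_meets_boundary Ay nAx.
have [w bw zw] := bAC _ bz.
exists w => //; apply: (le_lt_trans (ler_edistD z _ _)); rewrite ltrD//.
rewrite enormC zx//; first by rewrite enormC.
by rewrite subrr enorm0.
Qed.

(** The holes of radius [s / 2] of the sets [A_ n] survive in the limit at the
    cost of halving their radius. *)
Lemma porous_boundary_limit (r : R) (A_ : nat -> set 'rV[R]_d) C :
  (forall n, rolling_condition r (A_ n)) -> compact C ->
  (forall e : R, 0 < e ->
    \forall n \near \oo, eclose e (A_ n) C /\ eclose e C (A_ n)) ->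
  porous 4^-1 r (boundary C).
Proof.
move=> rA cC AC x s bx s0 sr; have s40 : 0 < s / 4 by rewrite divr_gt0.
have [n [[_ CAn] bCA]] := filter_ex
  (filterI (AC _ s40) (boundary_limit_eclose cC AC s40)).
have [x' bx' xx'] := bCA _ bx.
have s20 : 0 < s / 2 by rewrite divr_gt0.
have s2r : s / 2 <= r by rewrite (le_trans _ sr)// ler_pdivrMr// ler_pMr// ler1n.
have [y yx' hole] := rolling_hole (rA n) bx' s20 s2r.
exists y.
  rewrite (le_trans (ler_edistD x' _ _))//.
  by rewrite (enormC x'); lra.
apply/seteqP; split=> // z [bz]; rewrite /open_eball/= => zy.
have [z' Az' zz'] := CAn _ (boundary_sub (compact_rV_closed cC) bz).
suff : (A_ n `&` open_eball y (s / 2)) z' by rewrite hole.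
split=> //; rewrite /open_eball/=.
apply: (le_lt_trans (ler_edistD z _ _)); rewrite (enormC z').
by lra.
Qed.

End BoundaryConvergence.

(** * Convergence in measure *)

Section BorelMeasure.
Context {R : realType} {d : nat}.
Implicit Types (A K : set 'rV[R]_d).

Lemma open_measurable_rV A : open A -> measurable (A : set (borel_rV R d)).
Proof. exact: sub_sigma_algebra. Qed.

Lemma closed_measurable_rV A : closed A -> measurable (A : set (borel_rV R d)).
Proof.
move=> clA; rewrite -(setCK A); apply: measurableC.
by apply: open_measurable_rV; exact: closed_openC.
Qed.

(** Continuity from above along the open neighbourhoods of [K] of radius
    [1 / (n + 1)], whose intersection is [K] because [K] is closed. *)
Lemma small_measure_neighborhood
    (nu : {measure set (borel_rV R d) -> \bar R}) K (e : R) :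
  (forall K' : set 'rV[R]_d, compact K' -> (nu K' < +oo)%E) ->
  compact K -> nu K = 0%E -> 0 < e ->
  exists2 h : R, 0 < h & forall A, measurable (A : set (borel_rV R d)) ->
    eclose h A K -> (nu A < e%:E)%E.
Proof.
move=> nu_compact cK nuK0 e0.
pose F n : set (borel_rV R d) := \bigcup_(y in K) open_eball y n.+1%:R^-1.
have mF n : measurable (F n).
  apply: open_measurable_rV; apply: bigcup_open => y _.
  exact: open_open_eball.
have capF : \bigcap_n F n = K.
  apply/seteqP; split=> [x Fx|x Kx n _]; last first.
    by exists x => //; rewrite /open_eball/= subrr enorm0 invr_gt0.
  apply: (compact_rV_closed cK) => B /nbhs_eballP[h h0 hB].
  pose n := Num.bound h^-1.
  have [y Ky xy] := Fx n I.
  exists y; split=> //; apply: hB; rewrite /open_eball/= enormC.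
  apply: (lt_trans xy); rewrite -[ltRHS]invrK ltf_pV2 ?posrE ?invr_gt0//.
  apply: (lt_trans (archi_boundP _)); first by rewrite invr_ge0 ltW.
  by rewrite ltr_nat.
have F0fin : (nu (F 0%N) < +oo)%E.
  (* The closure of the bounded set [F 0] is compact. *)
  have [M KM] := compact_sub_eball cK.
  pose B : set 'rV[R]_d := closure (F 0%N).
  have clB : closed B by exact: closed_closure.
  have cB : compact B.
    apply: bounded_closed_compact => //; apply: (@bounded_eball _ _ _ 0 (M + 2)).
    move=> x /(_ _ (nbhs_open_eball x ltr01))[z [[y Ky zy] xz]].
    move: (KM _ Ky) zy xz; rewrite /open_eball /closed_eball/= !subr0 invr1.
    move=> yM zy xz; have := ler_edistD z x 0; have := ler_edistD y z 0.
    by rewrite !subr0 (enormC x z); lra.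
  apply: le_lt_trans (nu_compact _ cB); apply: le_measure; rewrite ?inE//.
  - exact: closed_measurable_rV.
  - exact: subset_closure.
have Fmono : {homo F : n m / (n <= m)%N >-> (m <= n)%O}.
  move=> n m nm; apply/subsetPset => x [y Ky xy]; exists y => //.
  rewrite /open_eball/= (lt_le_trans xy)// lef_pV2 ?posrE// ler_nat.
  by rewrite ltnS.
have mK : measurable (K : set (borel_rV R d)).
  by apply: closed_measurable_rV; exact: compact_rV_closed.
have := nonincreasing_cvg_mu F0fin mF.
rewrite capF => /(_ mK Fmono); rewrite nuK0 => nuF_cvg.
have nuF_ge0 n : (0 <= (nu \o F) n)%E by exact: measure_ge0.
have /filter_ex[n nuFe] : \forall n \near \oo, ((nu \o F) n < e%:E)%E.
  by apply: (iffLR (cvge0P nuF_ge0)).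
exists n.+1%:R^-1; first by rewrite invr_gt0.
move=> A mA AK; apply: le_lt_trans nuFe; apply: le_measure; rewrite ?inE//.
Qed.

End BorelMeasure.

Theorem theorem3 (R : realType) (d : nat) (r : R)
    (S_ : nat -> set 'rV[R]_d) (S : set 'rV[R]_d)
    (r_gt0 : 0 < r)
    (cS_ : forall n, compact (S_ n))
    (S_neq0 : forall n, S_ n !=set0)
    (S_rolling : forall n, rolling_condition r (S_ n))
    (cS : compact S)
    (S0 : S !=set0)
    (S_cvg : hausdorff_dist (S_ n) S @[n --> \oo] --> 0%E) :
  hausdorff_dist (boundary (S_ n)) (boundary S) @[n --> \oo] --> 0%E
  /\
  ((forall n, (r%:E <= reach (S_ n))%E) ->
   forall nu : {measure set (borel_rV R d) -> \bar R},
     (forall K : set 'rV[R]_d, compact K -> (nu K < +oo)%E) ->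
     nu `<< @lebesgue_rV R d ->
     dist_measure nu (S_ n) S @[n --> \oo] --> 0%E).
Proof.
have clS_ n : closed (S_ n) := compact_rV_closed (cS_ n).
have bS_cvg := boundary_hausdorff_cvg r_gt0 clS_ S_rolling cS S_cvg.
split=> // _ nu nu_compact nu_abs.
have SS := (hausdorff_cvg0P S_ S).1 S_cvg.
have bSS := (hausdorff_cvg0P _ _).1 bS_cvg.
have cbS := compact_boundary cS.
have porS := porous_boundary_limit S_rolling cS SS.
have nubS0 : nu (boundary S) = 0%E.
  apply: (nu_abs (boundary S)) => //; last first.
    by apply: closed_measurable_rV; exact: closed_boundary.
  move=> A _; apply: (porous_lebesgue_null _ r_gt0 cbS porS).
  by rewrite invr_gt0.
apply/cvge0P => [n|e e0]; first exact: measure_ge0.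
have [h h0 hP] := small_measure_neighborhood nu_compact cbS nubS0 e0.
have h20 : 0 < h / 2 by rewrite divr_gt0.
apply: filterS2 (SS _ h20) (bSS _ h20) => n [SnS SSn] [bSnS _].
apply: hP.
  by apply: measurableU; apply: measurableD; apply: closed_measurable_rV;
    exact: compact_rV_closed.
have -> : h = h / 2 + h / 2 by lra.
exact: symdiff_near_boundary.
Qed.
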